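(* For any covexillary $\tau\in S_n$, the set $\mathbf{C}(\tau)$ is admissible. Therefore, the map $\tau\mapsto\pi(\mathbf{C}(\tau))$ is an idempotent function from the set of covexillary permutations in $S_n$ onto the subset of smooth permutations. Moreover, this map is order preserving (for the Bruhat order), and for any covexillary $\tau\in S_n$, $$\pi(\mathbf{C}(\tau))=\min\{\sigma\in S_n\text{ smooth}:\sigma\ge\tau\},$$ the minimum being the least element with respect to the Bruhat order.
   Context: $S_n$ is the group of permutations of $[n]=\{1,\dots,n\}$, $n\ge1$, with the Bruhat order $\le$: $\tau\le\sigma$ iff $\#(\tau([i])\cap[j])\ge\#(\sigma([i])\cap[j])$ for all $i,j\in[n]$. A permutation is covexillary if it avoids the pattern $3412$. $\mathcal{T}=\{T_{i,j}:1\le i<j\le n\}$ is the set of transpositions; for $i<j<k$, $R_{i,j,k}$ is the $3$-cycle $i\mapsto j\mapsto k\mapsto i$; $\mathcal{C}^{2,3}=\mathcal{T}\cup\{R_{i,j,k},R_{i,j,k}^{-1}:i<j<k\}$. For $\sigma\in S_n$, $\mathbf{C}(\sigma)=\{\tau\in\mathcal{C}^{2,3}:\tau\le\sigma\}$. A permutation $\sigma$ is smooth if $\#\{i<j:\sigma(i)>\sigma(j)\}=\#\{T\in\mathcal{T}:T\le\sigma\}$ (equivalently, as is known, $\sigma$ avoids $4231$ and $3412$; in particular smooth permutations are covexillary). A subset $A\subseteq\mathcal{C}^{2,3}$ is admissible if (a) it is downward closed: $\sigma\in A$, $\tau\in\mathcal{C}^{2,3}$, $\tau\le\sigma$ imply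 $\tau\in A$; (b) if $R_{i,j,l},R_{i,k,l}^{-1}\in A$ with $i<j<l$, $i<k<l$, then $T_{i,l}\in A$; (c) whenever $T_{i,j},T_{j,k}\in A$ with $i<j<k$, at least one of $R_{i,j,k},R_{i,j,k}^{-1}$ belongs to $A$. For admissible $A$, $\pi(A)$ denotes the greatest element, with respect to the Bruhat order, of $\{\tau\in S_n:\mathbf{C}(\tau)=A\}$ (this greatest element exists). *)

(* Defs.v *)
From mathcomp Require Import all_boot all_fingroup.

Set Implicit Arguments.
Unset Strict Implicit.
Unset Printing Implicit Defensive.

(* The set [n] = {1, ..., n} is represented by 'I_n = {0, ..., n-1}. *)

Section Permutations.
Variable n : nat.
Implicit Types (s t : 'S_n) (i j k l : 'I_n) (A B : {set 'S_n}).

(* The element i of 'I_n stands for i + 1, so this is the interval [i + 1];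
   every [i] with 1 <= i <= n arises in this way. *)
Definition initial i : {set 'I_n} := [set x : 'I_n | x <= i].

Definition bruhat : rel 'S_n := fun t s =>
  [forall i : 'I_n, forall j : 'I_n,
    #|(s @: initial i) :&: initial j| <= #|(t @: initial i) :&: initial j|].

Definition greatest B s := (s \in B) && [forall t in B, bruhat t s].
Definition least B s := (s \in B) && [forall t in B, bruhat s t].

(* Some increasing sequence f of positions carries values of s in the same
   relative order as the letters of the word w (in one-line notation). *)
Definition contains_pattern (w : seq nat) s :=
  [exists f : {ffun 'I_(size w) -> 'I_n},
    [forall a : 'I_(size w), forall b : 'I_(size w),
      (a < b) ==>
        (f a < f b) && ((s (f a) < s (f b)) == (nth 0 w a < nth 0 w b))]].

Definition covexillary s := ~~ contains_pattern [:: 3; 4; 1; 2] s.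

(* In MathComp (s * t)%g x = t (s x). *)
Definition cycle3 i j k : 'S_n := (tperm i j * tperm i k)%g.

Lemma cycle3E i j k : i < j -> j < k ->
  [/\ cycle3 i j k i = j, cycle3 i j k j = k & cycle3 i j k k = i].
Proof.
move=> ij jk; have ik := ltn_trans ij jk.
have ne (x y : 'I_n) : x < y -> x != y.
  by move=> xy; rewrite -val_eqE /= ltn_eqF.
split; rewrite permM.
- by rewrite tpermL tpermD ?(ne i j) // eq_sym ne.
- by rewrite tpermR tpermL.
- by rewrite (@tpermD _ i j k) ?ne // tpermR.
Qed.

Definition transpositions : {set 'S_n} :=
  [set t | [exists i : 'I_n, exists j : 'I_n, (i < j) && (t == tperm i j)]].

Definition cycles23 : {set 'S_n} :=
  transpositions :|:
  [set t | [exists i : 'I_n, exists j : 'I_n, exists k : 'I_n,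
    [&& i < j, j < k & (t == cycle3 i j k) || (t == (cycle3 i j k)^-1%g)]]].

Definition cycles_below s : {set 'S_n} := [set t in cycles23 | bruhat t s].

Definition inversions s : {set 'I_n * 'I_n} :=
  [set p : 'I_n * 'I_n | (p.1 < p.2) && (s p.2 < s p.1)].

Definition smooth s :=
  #|inversions s| == #|[set t in transpositions | bruhat t s]|.

Record admissible A : Prop := Admissible {
  adm_sub : A \subset cycles23;
  adm_down : forall s t, s \in A -> t \in cycles23 -> bruhat t s -> t \in A;
  adm_cycles : forall i j k l, i < j -> j < l -> i < k -> k < l ->
    cycle3 i j l \in A -> (cycle3 i k l)^-1%g \in A -> tperm i l \in A;
  adm_transp : forall i j k, i < j -> j < k ->
    tperm i j \in A -> tperm j k \in A ->
    cycle3 i j k \in A \/ (cycle3 i j k)^-1%g \in A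
}.

(* The default value 1 is used only when there is no greatest element. *)
Definition pi_adm A : 'S_n :=
  odflt 1%g [pick s | greatest [set t | cycles_below t == A] s].

End Permutations.

(* Main.v *)
Require Import Defs.
From mathcomp Require Import all_boot all_fingroup zify.

(* Let p s x and q s x be the largest values taken on [0, x] by s and by its
   inverse; they record the left-to-right maxima and right-to-left minima.  A
   transposition or 3-cycle lies below s exactly when a few inequalities between
   p s, q s and its indices hold, so p s and q s determine C(s).  If s is
   covexillary, then conversely p r <= p s and q r <= q s whenever C(r) = C(s),
   because at each jump of p s its value is at most that of q s, so that a
   transposition or 3-cycle detects it.

   Permutations avoiding 3412 and 4231 are defined by inclusions: s is above r
   as soon as p r <= p s and q r <= q s.  Starting from a covexillary s,
   exchanging the middle letters of occurrences of 4231 changes neither p s nor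
   q s, and when none is left there is no 3412 either, since the jumps of p s
   and q s would then exhibit a 3412 in s itself.  The permutation reached is
   therefore the greatest one with p and q bounded by p s and q s; this is
   pi(C(s)), and order preservation and minimality follow from the
   monotonicity of p and q.

   That smooth permutations are those avoiding 3412 and 4231 is proved by
   deleting the maximal value, which decreases the number of transpositions
   below s by at least as much as the number of inversions, and by exactly as
   much in the absence of the patterns. *)

Set Implicit Arguments.
Unset Strict Implicit.
Unset Printing Implicit Defensive.

(* [ne s x y] means p s x >= y, hence [ne s^-1 x y] means q s x >= y. *)
Definition ne n (s : 'S_n) (x y : nat) :=
  [exists a : 'I_n, (a <= x) && (y <= s a)].

(** Positions are bounded strictly here but weakly in [ne], so that [x = 0] gives an empty quadrant;
    hence the shift in [ne_count_gt0]. *)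
Definition ne_count n (s : 'S_n) (x y : nat) :=
  #|[set a : 'I_n | (a < x) && (y <= s a)]|.

Definition occ3412 n (s : 'S_n) (a b c d : 'I_n) :=
  [&& a < b, b < c, c < d, s c < s d, s d < s a & s a < s b].

Definition occ4231 n (s : 'S_n) (a b c d : 'I_n) :=
  [&& a < b, b < c, c < d, s d < s b, s b < s c & s c < s a].

Definition avoids n (occ : 'S_n -> 'I_n -> 'I_n -> 'I_n -> 'I_n -> bool) s :=
  forall a b c d, ~~ occ s a b c d.

Definition ne_le n (r s : 'S_n) :=
  (forall x y, ne r x y -> ne s x y) /\
  (forall x y, ne r^-1 x y -> ne s^-1 x y).

(** * Rank counts and the Bruhat order *)

Section Rank.
Variable n : nat.
Implicit Types (r s t : 'S_n) (a b c d i j k : 'I_n) (x y : nat).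

Lemma card_lt_ord x : x <= n -> #|[set a : 'I_n | a < x]| = x.
Proof.
move=> xn; rewrite cardsE -sum1_card.
by rewrite (big_ord_narrow xn) sum1_card card_ord.
Qed.

Lemma card_geq_ord x : #|[set a : 'I_n | x <= a]| = n - x.
Proof.
have [xn|nx] := leqP x n; last first.
  rewrite (_ : [set _ | _] = set0) ?cards0; first by lia.
  by apply/setP=> a; rewrite !inE; have := ltn_ord a; lia.
have -> : [set a : 'I_n | x <= a] = ~: [set a : 'I_n | a < x].
  by apply/setP=> a; rewrite !inE leqNgt.
by rewrite cardsCs setCK card_lt_ord // card_ord.
Qed.

Lemma neP s x y : reflect (exists2 a : 'I_n, a <= x & y <= s a) (ne s x y).
Proof.
apply: (iffP existsP) => [[a /andP[]]|[a ax ya]]; exists a => //.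
by rewrite ax.
Qed.

Lemma neVP s x y : reflect (exists2 b : 'I_n, y <= b & s b <= x) (ne s^-1 x y).
Proof.
apply: (iffP (neP _ _ _)) => [[a ax ya]|[b yb bx]].
  by exists (s^-1 a)%g => //; rewrite permKV.
by exists (s b) => //; rewrite permK.
Qed.

Lemma ne_mono s x y x' y' : x <= x' -> y' <= y -> ne s x y -> ne s x' y'.
Proof. by move=> xx' yy' /neP[a ax ya]; apply/neP; exists a; lia. Qed.

Lemma ne_count_gt0 s x y : (0 < ne_count s x.+1 y) = ne s x y.
Proof.
apply/card_gt0P/neP => [[a]|[a ax ya]]; first by rewrite inE ltnS => /andP[];
  exists a.
by exists a; rewrite inE ltnS ax.
Qed.

Lemma ne_countS s a y : ne_count s a.+1 y = (y <= s a) + ne_count s a y.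
Proof.
rewrite /ne_count (cardsD1 a) inE ltnS leqnn; congr (_ + _).
apply: eq_card => b; rewrite !inE -val_eqE /=; case: (y <= s b); lia.
Qed.

Lemma ne_count_col s x b :
  ne_count s x b = ((s^-1)%g b < x) + ne_count s x b.+1.
Proof.
rewrite /ne_count (cardsD1 (s^-1%g b)) inE permKV leqnn andbT; congr (_ + _).
apply: eq_card => a; rewrite !inE -(inj_eq (@perm_inj _ s)) permKV -val_eqE /=.
case: (a < x); lia.
Qed.

(** Both sides come from counting the points with position below [x] and value below [y], by
    positions and by values; this trades a north-east quadrant for the south-west one. *)
Lemma ne_countV s x y :
  x <= n -> y <= n -> ne_count s x y + y = x + ne_count s^-1 y x.
Proof.
move=> xn yn.
pose B := [set a : 'I_n | (a < x) && (s a < y)].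
have Ex : #|B| + ne_count s x y = x.
  rewrite -[RHS](card_lt_ord xn) -[RHS](cardsID [set a : 'I_n | s a < y]).
  by congr (_ + _); apply: eq_card => a; rewrite !inE -?leqNgt // andbC.
have Ey : #|B| + ne_count s^-1 y x = y.
  rewrite -[RHS](card_lt_ord yn) -[RHS](cardsID [set a : 'I_n | s^-1%g a < x]).
  rewrite -(card_imset B (@perm_inj _ s)).
  congr (_ + _); apply: eq_card => a; rewrite !inE -?leqNgt 1?andbC //.
  apply/imsetP/andP => [[c]|[]]; first by rewrite inE => /andP[cx cy] ->;
    rewrite permK.
  by move=> ax ay; exists (s^-1%g a); rewrite ?inE permKV // ax ay.
by lia.
Qed.

(** The count defining the Bruhat order is complementary to [ne_count], which reverses its
    inequalities. *)
Lemma card_initial s i j :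
  #|(s @: initial i) :&: initial j| + ne_count s i.+1 j.+1 = i.+1.
Proof.
rewrite -[RHS](@card_lt_ord i.+1) // -[RHS](cardsID [set a :
  'I_n | s a < j.+1]).
rewrite -[X in _ = X + _](card_imset _ (@perm_inj _ s)).
congr (_ + _); apply: eq_card => a; rewrite !inE -?leqNgt 1?andbC //.
apply/andP/imsetP => [[aj /imsetP[b]]|[b]]; rewrite inE.
  by move=> bi Ea; exists b => //; rewrite !inE -Ea !ltnS bi.
by rewrite !inE !ltnS => /andP[bi bj] ->; split=> //; apply/imsetP; exists b;
  rewrite ?inE.
Qed.

Lemma bruhatP t s :
  reflect (forall x y, ne_count t x y <= ne_count s x y) (bruhat t s).
Proof.
apply: (iffP forallP) => [ts x y|ts i]; last first.
  apply/forallP=> j; have := ts i.+1 j.+1.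
  by have := card_initial s i j; have := card_initial t i j; lia.
wlog xn : x / x <= n => [IH|].
  have [|nx] := leqP x n; first exact: IH.
  have E (u : 'S_n) : ne_count u x y = ne_count u n y.
    apply: eq_card => a; rewrite !inE.
    by rewrite ltn_ord (leq_trans (ltn_ord a) (ltnW nx)).
  by rewrite !E; apply: IH.
case: x xn => [|x] xn;
  first by rewrite (leq_trans _ (leq0n _)) // leqn0 cards_eq0;
  apply/eqP/setP=> a; rewrite !inE.
case: y => [|y].
  by apply: subset_leq_card; apply/subsetP=> a; rewrite !inE.
have [ny|yn] := leqP n y.
  rewrite (leq_trans _ (leq0n _)) // leqn0 cards_eq0; apply/eqP/setP=> a;
    rewrite !inE.
  by have := ltn_ord (t a); lia.
have /forallP/(_ (Ordinal yn))/= := ts (Ordinal xn).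
have := card_initial s (Ordinal xn) (Ordinal yn).
by have := card_initial t (Ordinal xn) (Ordinal yn); rewrite /=; lia.
Qed.

Lemma bruhat_trans s r t : bruhat r s -> bruhat s t -> bruhat r t.
Proof.
by move=> /bruhatP rs /bruhatP st; apply/bruhatP=> x y;
  apply: leq_trans (st x y).
Qed.

Lemma bruhatV t s : bruhat t^-1%g s^-1%g = bruhat t s.
Proof.
have card_setIV r i j :
    #|(r^-1%g @: initial i) :&: initial j| = #|(r @: initial j) :&: initial i|.
  rewrite -(card_imset _ (@perm_inj _ r)); congr #|pred_of_set _|.
  rewrite imsetI; last exact: (in2W perm_inj).
  by rewrite -imset_comp (eq_imset (g := id)) ?imset_id 1?setIC // => a;
    rewrite /= permKV.
apply/forallP/forallP => ts i; apply/forallP => j; have /forallP/(_ i) := ts j;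
  by rewrite !card_setIV.
Qed.

(** The rank counts determine the permutation: by [ne_countS] their increments tell whether
    [y <= s a]. *)
Lemma bruhat_anti s t : bruhat t s -> bruhat s t -> s = t.
Proof.
move=> /bruhatP ts /bruhatP st.
have E x y : ne_count s x y = ne_count t x y by apply/eqP;
  rewrite eqn_leq ts st.
apply/permP=> a; apply/val_inj.
have S y : (y <= s a) = (y <= t a).
  have := ne_countS s a y; rewrite !E ne_countS => /eqP.
  by rewrite eqn_add2r; case: (y <= s a); case: (y <= t a).
by apply/eqP; rewrite eqn_leq -S leqnn S leqnn.
Qed.

Lemma bruhat_ne t s x y : bruhat t s -> ne t x y -> ne s x y.
Proof. by move/bruhatP=> ts; rewrite -!ne_count_gt0 => /leq_trans->. Qed.

Lemma bruhat_ne_le t s : bruhat t s -> ne_le t s.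
Proof. by move=> ts; split=> x y; apply: bruhat_ne; rewrite ?bruhatV. Qed.

Lemma ne_le_trans s r t : ne_le r s -> ne_le s t -> ne_le r t.
Proof. by case=> rs rs' [st st']; split=> x y h;
  [apply/st/rs | apply/st'/rs']. Qed.

(** At a diagonal corner [ne_countV] makes the north-east and south-west counts equal. *)
Lemma ne_diagV s x : ne s x x.+1 -> ne s^-1 x x.+1.
Proof.
move=> sx; rewrite -ne_count_gt0.
have xn : x.+1 <= n by case/neP: sx => a _; have := ltn_ord (s a); lia.
by have := ne_countV s xn xn; move: sx; rewrite -ne_count_gt0; lia.
Qed.

Lemma ne_diag s x : ne s^-1 x x.+1 = ne s x x.+1.
Proof. by apply/idP/idP => /ne_diagV; rewrite ?invgK. Qed.

(* A thin permutation has at most one point in each quadrant [a <= x, y < t a]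
   with [x <= y], so its rank conditions only ask for such quadrants to be
   nonempty. *)
Definition thin t := forall a b, a < b -> b < t a -> b < t b -> False.

Lemma thin_ne_count t x y : thin t -> x <= y.+1 -> ne_count t x y.+1 <= 1.
Proof.
move=> tt xy; apply/card_le1P=> a; rewrite inE => /andP[ax ya] b; rewrite !inE.
apply/idP/eqP => [/andP[bx yb]|->]; last by rewrite ax.
apply/val_inj/eqP; rewrite eqn_leq.
by apply/andP; split; rewrite leqNgt; apply/negP => ab; case: (tt _ _ ab); lia.
Qed.

(** On one side of the diagonal all counts of [t] are at most 1, so its points there suffice as
    tests; [ne_countV] reduces the other side to the inverses. *)
Lemma bruhat_thin t s : thin t -> thin t^-1 ->
  reflect ((forall a, a < t a -> ne s a (t a)) /\
           (forall a, a < t^-1%g a -> ne s^-1 a (t^-1%g a)))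
          (bruhat t s).
Proof.
move=> tt ttV; apply: (iffP idP) => [ts|[h hV]].
  have [le leV] := bruhat_ne_le ts.
  by split=> a _; [apply: le|apply: leV]; apply/neP; exists a.
have key (u v : 'S_n) x y : thin u -> (forall a, a < u a -> ne v a (u a)) ->
    x <= y.+1 -> ne_count u x y.+1 <= ne_count v x y.+1.
  move=> tu hu xy; case: (posnP (ne_count u x y.+1)) => [->//|].
  case: x xy => [|x] xy.
    by move=> /card_gt0P[a]; rewrite inE.
  move=> u_gt0; apply: leq_trans (thin_ne_count tu xy) _.
  move: u_gt0; rewrite !ne_count_gt0 => /neP[a ax yu].
  by apply: (ne_mono _ _ (hu a _)); lia.
apply/forallP=> i; apply/forallP=> j.
have := card_initial s i j; have := card_initial t i j.
have [ij|ji] := leqP i j.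
  by have := key t s i.+1 j tt h; lia.
have := key _ _ j.+1 i ttV hV; have := ne_countV s (ltn_ord i) (ltn_ord j).
by have := ne_countV t (ltn_ord i) (ltn_ord j); lia.
Qed.

(** * Transpositions and 3-cycles in the Bruhat order *)

Lemma bruhat_tperm s i j : i < j ->
  bruhat (tperm i j) s = ne s i j && ne s^-1 i j.
Proof.
move=> ij.
have tE a : a < tperm i j a -> a = i /\ tperm i j a = j.
  by case: tpermP => [->|->|_ _] //; rewrite ?ltnn // ltnNge ltnW.
have tt : thin (tperm i j).
  by move=> a b ab ba bb; have [Ea _] := tE a (ltn_trans ab ba);
    have [Eb _] := tE b bb; move: ab; rewrite Ea Eb ltnn.
apply/bruhat_thin/andP; rewrite ?tpermV //.
  by case=> /(_ i) h /(_ i) hV; rewrite !tpermL in h hV; rewrite h ?hV.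
by case=> h hV; split=> a /tE[-> ->].
Qed.

Lemma cycle3_exceed i j k a : i < j -> j < k -> a < cycle3 i j k a ->
  a = i /\ cycle3 i j k a = j \/ a = j /\ cycle3 i j k a = k.
Proof.
move=> ij jk; have [Ei Ej Ek] := cycle3E ij jk.
have [->|ai] := eqVneq a i; first by left.
have [->|aj] := eqVneq a j; first by right.
have [->|ak] := eqVneq a k; first by rewrite Ek ltnNge ltnW // (ltn_trans ij).
by rewrite permM (@tpermD _ i j) 1?eq_sym // tpermD 1?eq_sym // ltnn.
Qed.

Lemma cycle3V_exceed i j k a : i < j -> j < k -> a < (cycle3 i j k)^-1%g a ->
  a = i /\ (cycle3 i j k)^-1%g a = k.
Proof.
move=> ij jk; have [Ei Ej Ek] := cycle3E ij jk.
set t := cycle3 i j k in Ei Ej Ek *.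
have Vi : t^-1%g i = k by rewrite -Ek permK.
have Vj : t^-1%g j = i by rewrite -Ei permK.
have Vk : t^-1%g k = j by rewrite -Ej permK.
have [->|ai] := eqVneq a i; first by [].
have [->|aj] := eqVneq a j; first by rewrite Vj ltnNge ltnW.
have [->|ak] := eqVneq a k; first by rewrite Vk ltnNge ltnW.
have -> : t^-1%g a = a.
  apply: (@perm_inj _ t); rewrite permKV permM.
  by rewrite (@tpermD _ i j) 1?eq_sym // tpermD 1?eq_sym.
by rewrite ltnn.
Qed.

(** The 3-cycle exceeds the diagonal only at [i -> j] and [j -> k], and its inverse only at
    [i -> k]. *)
Lemma bruhat_cycle3 s i j k : i < j -> j < k ->
  bruhat (cycle3 i j k) s = [&& ne s i j, ne s j k & ne s^-1 i k].
Proof.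
move=> ij jk; have [Ei Ej Ek] := cycle3E ij jk.
have EV : (cycle3 i j k)^-1%g i = k.
  by apply: (@perm_inj _ (cycle3 i j k)); rewrite permKV Ek.
apply/bruhat_thin/and3P.
- move=> a b ab ba bb.
  case: (cycle3_exceed ij jk (ltn_trans ab ba)) => [] [Ea Fa];
    case: (cycle3_exceed ij jk bb) => [] [Eb Fb]; subst; move: ab ba;
      rewrite ?Fa ?Fb; lia.
- move=> a b ab ba bb.
  case: (cycle3V_exceed ij jk (ltn_trans ab ba)) => Ea _.
  by case: (cycle3V_exceed ij jk bb) => Eb _; subst; rewrite ltnn in ab.
- case=> h hV; have := h i; have := h j; have := hV i; rewrite Ei Ej EV.
  by move=> hVi hj hi; split;
    [apply: hi | apply: hj | apply/hVi/(ltn_trans ij)].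
- case=> h1 h2 h3; split=> a.
    by case/(cycle3_exceed ij jk) => -[-> ->].
  by case/(cycle3V_exceed ij jk) => -> ->.
Qed.

Lemma bruhat_cycle3V s i j k : i < j -> j < k ->
  bruhat (cycle3 i j k)^-1%g s = [&& ne s^-1 i j, ne s^-1 j k & ne s i k].
Proof. by move=> ij jk; rewrite -bruhatV invgK bruhat_cycle3 // invgK. Qed.

(* Induction on the number of points of [s] north-east and south-west of the
   corner [(x, y)]: when the corner can be moved neither way without losing a
   violation, it is a corner of Fulton's essential set, and points on both
   sides of it form one of the two patterns. *)
Theorem ne_le_bruhat r s : avoids (@occ3412 n) s -> avoids (@occ4231 n) s ->
  ne_le r s -> bruhat r s.
Proof.
move=> s3412 s4231 [rs rsV].
suff main m x y : x <= n -> y <= n -> ne_count s x y + ne_count s^-1 y x < m ->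
    ne_count r x y <= ne_count s x y.
  apply/forallP=> i; apply/forallP=> j.
  have := main _ i.+1 j.+1 (ltn_ord i) (ltn_ord j) (ltnSn _).
  by have := card_initial s i j; have := card_initial r i j; lia.
elim: m x y => // m IH x y xn yn; rewrite ltnS => xym.
have [x0|x_gt0] := posnP x.
  by rewrite /ne_count leq_eqVlt; apply/orP; left; rewrite x0;
    apply/eqP; apply: eq_card => a; rewrite !inE.
have [NE0|] := posnP (ne_count s x y).
  rewrite leqNgt; apply/negP=> lt; move: NE0.
  have: 0 < ne_count r x y by lia.
  by case: x x_gt0 {xn xym lt} => // x _; rewrite ne_count_gt0 => /rs;
    rewrite -ne_count_gt0; lia.
have [SW0|] := posnP (ne_count s^-1 y x).
  move=> _; have := ne_countV s xn yn; have := ne_countV r xn yn.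
  suff: ne_count r^-1 y x = 0 by lia.
  apply/eqP; rewrite -leqn0 leqNgt; apply/negP; move: SW0; case: (y) => [|z].
    by move=> _ /card_gt0P[a]; rewrite inE.
  by rewrite ne_count_gt0 => sz /rsV; rewrite -ne_count_gt0 sz.
move=> /card_gt0P[d]; rewrite inE => /andP[dy]; set D := (s^-1%g d) => xD.
move=> /card_gt0P[a]; rewrite inE => /andP[ax ya].
have sD : s D = d by rewrite permKV.
case: x x_gt0 xn xym xD ax => // x _ xn xym xD ax.
case: y yn xym dy ya => // y yn xym dy ya.
pose X := Ordinal xn; pose Y := Ordinal yn.
(* The four unit moves of the corner are tried in turn. A possible move drops a point of [s] from
   one quadrant, leaves the other count unchanged, and would preserve a violation. *)
have [sX|sX] := leqP y.+1 (s X).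
  have := ne_countS s X y.+1; have := ne_countS r X y.+1; rewrite /= sX.
  have := ne_count_col (s^-1)%g y.+1 X; rewrite invgK ltnNge sX /= => E.
  by have := IH x y.+1 (ltnW xn) yn; case: (y < r X); lia.
set Z := (s^-1%g Y); have sZ : s Z = Y by rewrite permKV.
have [Zx|Zx] := leqP x.+1 Z.
  have := ne_count_col s x.+1 Y; rewrite /= -/Z ltnNge Zx /=.
  have := ne_countS (s^-1)%g Y x.+1; rewrite /= -/Z Zx.
  have := ne_count_col r x.+1 Y; rewrite /=.
  by have := IH x.+1 y xn (ltnW yn); lia.
have Xn : x.+1 < n by have := ltn_ord D; lia.
have Yn : y.+1 < n by have := ltn_ord (s a); lia.
pose X' := Ordinal Xn; pose Y' := Ordinal Yn.
have [sX'|sX'] := ltnP (s X') y.+1.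
  have := ne_countS s X' y.+1; have := ne_countS r X' y.+1;
    rewrite /= (leqNgt y.+1 (s X')) sX' /=.
  have := ne_count_col (s^-1)%g y.+1 X'; rewrite invgK /= sX'.
  by have := IH x.+2 y.+1 Xn yn; lia.
set Z' := (s^-1%g Y'); have sZ' : s Z' = Y' by rewrite permKV.
have [Z'x|Z'x] := ltnP Z' x.+1.
  have := ne_count_col s x.+1 Y'; rewrite /= -/Z' Z'x.
  have := ne_countS (s^-1)%g Y' x.+1; rewrite /= -/Z' (leqNgt x.+1 Z') Z'x /=.
  have := ne_count_col r x.+1 Y'; rewrite /=.
  by have := IH x.+1 y.+2 xn Yn; case: (_ < x.+1); lia.
have ne_val (u v : 'I_n) : s u <> s v -> (u :
  nat) <> v by move=> h /val_inj E; apply: h; rewrite E.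
have val_ne (u v : 'I_n) : (u : nat) <> v -> (s u :
  nat) <> s v by move=> h /val_inj/perm_inj E; apply: h; rewrite E.
have aX : (a : nat) <> x.
  by move=> E; have Ea : a = X by [apply/val_inj]; move: sX; rewrite -Ea; lia.
have aZ : (s a : nat) <> y.+1.
  move=> E; have Ea : Y' = s a by apply/val_inj.
  by move: Z'x; rewrite /Z' Ea permK; lia.
have DX' : (D : nat) <> x.+1.
  move=> E; have Ea : X' = D by apply/val_inj.
  by move: sX'; rewrite Ea sD; lia.
have DZ : (d : nat) <> y.
  move=> E; have Ea : Y = d by apply/val_inj.
  by move: Zx; rewrite /Z Ea -/D; lia.
(* The last column and the last row before the corner each offer a candidate for [p]; if both fail,
   [Z], [a], [X], [D] form a 3412. The letter [q] is found symmetrically beyond the corner. *)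
have [p [ap px pd py]] : exists p :
  'I_n, [/\ a < p, p <= x, d < s p & s p <= y].
  have [dX|Xd] := ltnP d (s X); first by exists X; split => //=; lia.
  have [aZ2|Za] := ltnP a Z; first by exists Z; rewrite sZ; split => //=; lia.
  have /negP[] := s3412 Z a X D; rewrite /occ3412 sZ sD /=.
  have : s X <> d :> nat by rewrite -sD; apply: val_ne => /=; lia.
  have : (Z : nat) <> a by apply: ne_val; rewrite sZ => E; move: ya;
    rewrite -E /=; lia.
  lia.
have [q [xq qD qy qa]] : exists q :
  'I_n, [/\ x < q, q < D, y < s q & s q < s a].
  have [Xa|aX'] := ltnP (s X') (s a); first by exists X'; split => //=; lia.
  have [ZD|DZ'] := ltnP Z' D; first by exists Z'; rewrite sZ'; split => //=;
    lia.
  have /negP[] := s3412 a X' D Z'; rewrite /occ3412 sZ' sD /=.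
  have : s X' <> s a :> nat by apply: val_ne => /=; lia.
  have : (Z' : nat) <> D by apply: ne_val; rewrite sZ' sD => E; move: dy;
    rewrite -E /=; lia.
  lia.
by have /negP[] := s4231 a p q D; rewrite /occ4231 sD; lia.
Qed.

End Rank.

(** * Smoothness as a count of pairs *)

Definition tpairs n (s : 'S_n) : {set 'I_n * 'I_n} :=
  [set p : 'I_n * 'I_n | [&& p.1 < p.2, ne s p.1 p.2 & ne s^-1 p.1 p.2]].

Lemma smoothE n (s : 'S_n) : smooth s = (#|inversions s| == #|tpairs s|).
Proof.
pose f (p : 'I_n * 'I_n) := tperm p.1 p.2.
have finj : {in tpairs s &, injective f}.
  move=> [i j] [k l]; rewrite !inE /f /= => /and3P[ij _ _] /and3P[kl _ _] E.
  have: tperm k l i = j by rewrite -E tpermL.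
  case: tpermP => [-> -> //|Ei Ek|_ _ Ei].
    by move: ij kl; rewrite Ei Ek; lia.
  by move: ij; rewrite Ei ltnn.
rewrite /smooth -(card_in_imset finj); congr (_ == #|pred_of_set _|).
apply/setP=> t; rewrite !inE; apply/andP/imsetP => [[]|[[i j]]].
  case/existsP=> i /existsP[j /andP[ij /eqP->]]; rewrite bruhat_tperm // => h.
  by exists (i, j); rewrite // inE /= ij.
rewrite inE /= => /andP[ij h] ->; rewrite bruhat_tperm //; split=> //.
by apply/existsP; exists i; apply/existsP; exists j; rewrite ij /=.
Qed.

(** * Deleting the maximal value *)

Section Deletion.
Variable n : nat.
Implicit Types (s : 'S_n) (j : 'I_n.+1).

Lemma lift_permP (s : 'S_n.+1) j : exists s', s = lift_perm j (s j) s'.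
Proof.
pose f k := odflt k (unlift (s j) (s (lift j k))).
have fE k : lift (s j) (f k) = s (lift j k).
  rewrite /f; case: unliftP => [l -> //|/perm_inj/eqP].
  by rewrite eq_sym (negbTE (neq_lift _ _)).
have finj : injective f.
  by move=> k l E; apply/(@lift_inj _ j)/(@perm_inj _ s); rewrite -!fE E.
exists (perm finj); apply/permP=> k; case: (unliftP j k) => [l ->|->].
  by rewrite lift_perm_lift permE fE.
by rewrite lift_perm_id.
Qed.

Definition insert_max j s : 'S_n.+1 := lift_perm j ord_max s.

Lemma insert_max_id j s : insert_max j s j = ord_max.
Proof. exact: lift_perm_id. Qed.

Lemma insert_max_lift j s k : insert_max j s (lift j k) = s k :> nat.
Proof. by rewrite lift_perm_lift lift_max. Qed.

Lemma insert_maxP j s b : insert_max j s b != ord_max -> exists k, b = lift j k.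
Proof. by case: (unliftP j b) => [k ->|->];
  [exists k | rewrite insert_max_id eqxx]. Qed.

Lemma lift_lt j (k l : 'I_n) : (lift j k < lift j l) = (k < l).
Proof. by rewrite /= /bump; case: leqP; case: leqP; lia. Qed.

Lemma bump_max (i : 'I_n) : bump n i = i.
Proof. exact: (lift_max i). Qed.

(** It indexes both the inversions and the adjacent pairs that inserting the maximal value at [j]
    creates. *)
Definition suffix_from j : {set 'I_n} := [set i : 'I_n | j <= i].

Lemma card_inversions_insert_max j s :
  #|inversions (insert_max j s)| = #|inversions s| + #|suffix_from j|.
Proof.
pose f (p : 'I_n * 'I_n) := (lift j p.1, lift j p.2).
pose g (b : 'I_n) := (j, lift ord0 b).
have finj : injective f by move=> [a b] [c d] /eqP;
  rewrite xpair_eqE !(inj_eq lift_inj) /= => /andP[/eqP-> /eqP->].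
have ginj : injective g by move=> a b /eqP;
  rewrite xpair_eqE eqxx (inj_eq lift_inj) => /eqP.
rewrite -(card_imset _ finj) -(card_imset _ ginj) -cardsUI.
rewrite (_ : _ :&: _ = set0) ?cards0 ?addn0; last first.
  apply/setP=> p; rewrite !inE;
    apply/andP => [[/imsetP[[a b] _ ->] /imsetP[c _ [E _]]]].
  by have := neq_lift j a; rewrite E eqxx.
apply: eq_card => -[a b]; rewrite !inE /=.
apply/andP/orP => [[ab sba]|[/imsetP[[k l]]|/imsetP[l]]].
- have [k Eb] : exists k, b = lift j k.
    by apply: (@insert_maxP _ s); apply: contraTN sba => /eqP->;
      rewrite -leqNgt leq_ord.
  case: (unliftP j a) => [l Ea|Ea].
    left; apply/imsetP; exists (l, k); rewrite /f /= ?Ea ?Eb //.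
    by rewrite inE /= -(lift_lt j) -Ea -Eb ab -!(insert_max_lift j) -Ea -Eb.
  right; apply/imsetP; subst a.
  exists k; first by move: ab; rewrite inE Eb /= /bump; lia.
  congr pair; apply/val_inj; rewrite Eb /=; move: ab; rewrite Eb /= /bump; lia.
- by rewrite inE /= => /andP[kl skl] [-> ->]; rewrite lift_lt !insert_max_lift.
- rewrite inE => jl [-> ->]; split; first by rewrite lift0; lia.
  have -> : lift ord0 l = lift j l by apply/val_inj; rewrite /= /bump jl.
  by rewrite insert_max_lift insert_max_id /=.
Qed.

(* Pairs of [insert_max j s] that come from those of [s], respectively that the
   inserted maximal value creates. *)
Definition inherited_pair j (p : 'I_n * 'I_n) : 'I_n.+1 * 'I_n.+1 :=
  (lift ord_max p.1, if j <= p.1 then lift ord0 p.2 else lift ord_max p.2).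
Definition adjacent_pair (i : 'I_n) :
  'I_n.+1 * 'I_n.+1 := (lift ord_max i, lift ord0 i).
Definition known_pairs j s :=
  inherited_pair j @: tpairs s :|: adjacent_pair @: suffix_from j.

Lemma inherited_pairE j p :
  ((inherited_pair j p).1 = p.1 :> nat) * ((inherited_pair j p).2 =
    (j <= p.1) + p.2 :> nat).
Proof.
by rewrite /inherited_pair /= bump_max; split=> //; case: ifP => _;
  rewrite /= ?bump_max.
Qed.

Lemma inherited_pair_eq j (p : 'I_n * 'I_n) (i k : 'I_n.+1) :
  p.1 = i :> nat -> (j <= i) + p.2 = k :> nat -> (i, k) = inherited_pair j p.
Proof.
have [E1 E2] := inherited_pairE j p; move=> Ei Ek;
  rewrite [RHS]surjective_pairing.
by congr pair; apply/val_inj/esym; [apply: (etrans E1) | apply: (etrans E2);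
  rewrite Ei].
Qed.

Lemma card_known_pairs j s :
  #|known_pairs j s| = #|tpairs s| + #|suffix_from j|.
Proof.
have finj : injective (inherited_pair j).
  move=> p q E; move: (inherited_pairE j p) (inherited_pairE j q);
    rewrite E => -[-> ->] [E1 E2].
  apply/eqP; rewrite [p]surjective_pairing [q]surjective_pairing -pair_eqE /=.
  by rewrite -!val_eqE /= E1 eqxx /= -(eqn_add2l (j <= q.1)) -E2 E1.
have ginj : injective adjacent_pair by move=> a b /eqP;
  rewrite xpair_eqE !(inj_eq lift_inj) andbb => /eqP.
rewrite -(card_imset _ finj) -(card_imset _ ginj) -cardsUI.
rewrite (_ : _ :&: _ = set0) ?cards0 ?addn0 //.
apply/setP=> p; rewrite !inE; apply/andP=> [[/imsetP[q]]].
rewrite inE => /and3P[q12 _ _] -> /imsetP[i]; rewrite inE => ji E.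
have := inherited_pairE j q; rewrite E /= bump_max => -[E1 E2].
by move: E2; rewrite -E1 ji /bump /=; lia.
Qed.

(** For [j <= i] the raised second index is reached by the maximal value at [j] on one side and by
    the shift of positions after [j] on the other. An adjacent pair needs one side only, by
    [ne_diag]. *)
Lemma known_pairs_sub j s : known_pairs j s \subset tpairs (insert_max j s).
Proof.
apply/subUsetP; split; apply/subsetP=> p /imsetP[].
  move=> [i k]; rewrite inE /= => /and3P[ik /neP[a ai ka] /neVP[b kb bi]] ->.
  rewrite inE !inherited_pairE /=.
  apply/and3P; split; first by case: leqP; lia.
    case: leqP => ji; last by apply/neP; exists (lift j a);
      rewrite ?insert_max_lift //= /bump; lia.
    by apply/neP; exists j => //; rewrite insert_max_id /=;
      have := ltn_ord k; lia.
  by apply/neVP; exists (lift j b); rewrite ?insert_max_lift //= /bump; lia.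
move=> i; rewrite inE => ji ->; rewrite inE /adjacent_pair /= bump_max ltnSn /=.
suff D : ne (insert_max j s) i i.+1 by rewrite D ne_diag D.
by apply/neP; exists j => //; rewrite insert_max_id /=; have := ltn_ord i; lia.
Qed.

Lemma card_tpairs_insert_max j s :
  #|tpairs s| + #|suffix_from j| <= #|tpairs (insert_max j s)|.
Proof. by rewrite -card_known_pairs subset_leq_card ?known_pairs_sub. Qed.

(* The pair [(0, c)] is a transposition below [s] which is not inherited from
   the permutation with the maximal value deleted. *)
Lemma card_tpairs_insert_max_lt j s (a c : 'I_n.+1) :
  a < j -> j < c -> a = ord0 -> insert_max j s c =
    ord0 -> c <= insert_max j s a ->
  #|tpairs s| + #|suffix_from j| < #|tpairs (insert_max j s)|.
Proof.
move=> aj jc a0 sc ca; rewrite -card_known_pairs; apply: proper_card.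
rewrite properE known_pairs_sub; apply/subsetPn; exists (a, c).
  rewrite inE; apply/and3P; split; first exact: ltn_trans jc.
    by apply/neP; exists a.
  by apply/neVP; exists c; rewrite ?sc.
rewrite inE; apply/norP; split; apply/imsetP => -[].
  move=> [i k]; rewrite inE /= => /and3P[ik _ /neVP[b kb bi]] [Ea].
  have Ei : a = i :> nat by rewrite Ea /= bump_max.
  rewrite leqNgt -Ei aj /= => Ec.
  have Ek : c = k :> nat by rewrite Ec /= bump_max.
  have : insert_max j s (lift j b) = insert_max j s c.
    by apply/val_inj; rewrite sc /= insert_max_lift; move: bi;
      rewrite -Ei a0 /=; lia.
  move=> /perm_inj /(congr1 val) /=; rewrite /bump; lia.
by move=> i; rewrite inE => ji [Ea _]; move: aj; rewrite Ea /= bump_max; lia.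
Qed.

Lemma occ3412_insert_max j s a b c d :
  occ3412 (insert_max j s) (lift j a) (lift j b) (lift j c) (lift j d) =
    occ3412 s a b c d.
Proof. by rewrite /occ3412 !insert_max_lift !lift_lt. Qed.

Lemma occ4231_insert_max j s a b c d :
  occ4231 (insert_max j s) (lift j a) (lift j b) (lift j c) (lift j d) =
    occ4231 s a b c d.
Proof. by rewrite /occ4231 !insert_max_lift !lift_lt. Qed.

Lemma perm_pigeon m (s : 'S_m) (A B : {set 'I_m}) :
  (forall a, a \in A -> s a \in B) -> #|A| <= #|B|.
Proof.
move=> AB; rewrite -(card_imset A (@perm_inj _ s)).
by apply/subset_leq_card/subsetP => _ /imsetP[a /AB h ->].
Qed.

(* Conversely, in the absence of the patterns every pair is inherited or new; a
   missing pair forces one of them by counting positions against values. *)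
Lemma tpairs_sub_known j s : avoids (@occ3412 n.+1) (insert_max j s) ->
  avoids (@occ4231 n.+1) (insert_max j s) ->
    tpairs (insert_max j s) \subset known_pairs j s.
Proof.
have [t Et] : exists t : 'S_n.+1, t = insert_max j s by exists (insert_max j s).
rewrite -Et => t3412 t4231; have tj : t j = ord_max by rewrite Et insert_max_id.
have t_lift (k : 'I_n) :
  t (lift j k) = s k :> nat by rewrite Et insert_max_lift.
have tmax (a : 'I_n.+1) : a != j -> t a < n.
  by move=> aj; rewrite ltn_neqAle -ltnS ltn_ord andbT;
    apply: contra aj => /eqP E;
    apply/eqP/(@perm_inj _ t)/val_inj; rewrite tj.
have inj (u v : 'I_n.+1) :
  t u = t v :> nat -> u = v by move=> /val_inj/perm_inj.
apply/subsetP=> -[i k];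
  rewrite inE /= => /and3P[ik /neP[a ai ka] /neVP[b kb bi]].
have i_n : i < n by have := ltn_ord k; lia.
have bj : b != j by apply: contraTneq bi => ->; rewrite tj -ltnNge.
have ltb := tmax b bj.
rewrite inE; apply/orP.
have [ji|ij] := leqP j i; last first.
  have aj : a != j by apply: contraTneq ij => <-; rewrite -leqNgt.
  have kn : k < n by apply: leq_ltn_trans ka (tmax a aj).
  left; apply/imsetP; exists (Ordinal i_n, Ordinal kn); last first.
    by apply: inherited_pair_eq => //=; lia.
  rewrite inE; apply/and3P; split=> //.
    apply/neP; case: (unliftP j a) => [a0 Ea|/eqP]; last by rewrite (negbTE aj).
    exists a0; last by rewrite -t_lift -Ea.
    by move: ai; rewrite Ea /= /bump; lia.
  (* Positions after [j] drop by one on deletion, so a witness there must exceed [k]. If there is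
     none, then [b = k], and avoiding 3412 sends [j] and all positions after [k] to values above
     [t a], which are too few. *)
  have [b' [kb' b'j tb']] : exists b' :
    'I_n.+1, [/\ k + (j < b') <= b', b' != j & t b' <= i].
    have [kb'|bk] := leqP (k + (j < b)) b; first by exists b.
    have [/existsP[b' /andP[kb' tb']]|/existsPn none] :=
      boolP [exists b' : 'I_n.+1, (k < b') && (t b' <= i)].
      exists b'; split=> //; first by lia.
      by apply: contraTneq tb' => ->; rewrite tj -ltnNge.
    have jk : j < k by lia.
    have {bk} Eb : b = k by apply/val_inj => /=; lia.
    rewrite {b bj ltb kb}Eb in bi.
    have : #|j |: [set p : 'I_n.+1 | k < p]| <= #|[set v : 'I_n.+1 | t a < v]|.
      apply: (@perm_pigeon _ t) => p; rewrite !inE => /orP[/eqP->|kp].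
        by rewrite tj tmax.
      rewrite ltnNge leq_eqVlt; apply/negP => /orP[/eqP/inj E|lt].
        by move: kp; rewrite E; lia.
      have := none p; have := t3412 a j k p; rewrite /occ3412 kp tj /=.
      by have := tmax a aj; lia.
    by rewrite cardsU1 !card_geq_ord inE; have := tmax a aj; lia.
  apply/neVP; case: (unliftP j b') => [b0 Eb|/eqP];
    last by rewrite (negbTE b'j).
  exists b0; last by rewrite -t_lift -Eb.
  by move: kb'; rewrite Eb /= /bump; lia.
have [Ek|ki] := eqVneq (k : nat) i.+1.
  right; apply/imsetP; exists (Ordinal i_n); first by rewrite inE.
  by rewrite /adjacent_pair; congr pair; apply/val_inj;
    [rewrite [RHS]lift_max | rewrite [LHS]Ek].
have kn : k.-1 < n by have := ltn_ord k; lia.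
left; apply/imsetP; exists (Ordinal i_n, Ordinal kn); last first.
  by apply: inherited_pair_eq => //=; lia.
rewrite inE; apply/and3P; split; first by move=> /=; lia.
  apply/neP.
  have [/existsP[a' /and3P[a'i a'j ka']]|/existsPn none] :=
    boolP [exists a' : 'I_n.+1, [&& a' <= i.+1, a' != j & k.-1 <= t a']].
    case: (unliftP j a') => [a0 Ea|/eqP]; last by rewrite (negbTE a'j).
    exists a0; last by rewrite -t_lift -Ea.
    by move: a'i; rewrite Ea /= /bump; lia.
  (* The values from [k.-1] on outnumber [j] together with the positions after [b]. *)
  have [z [zb zj kz]] : exists z : 'I_n.+1, [/\ z <= b, z != j & k.-1 <= t z].
    have [/existsP[z /and3P[]]|/existsPn nz] :=
      boolP [exists z : 'I_n.+1, [&& z <= b, z != j & k.-1 <= t z]].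
      by exists z.
    have : #|[set v : 'I_n.+1 | k.-1 <= v]| <= #|j |: [set p :
      'I_n.+1 | b < p]|.
      apply: (@perm_pigeon _ t^-1%g) => v; rewrite !inE => kv.
      have := nz (t^-1%g v); rewrite permKV kv andbT.
      by case: eqP => //= _; rewrite andbT -ltnNge.
    rewrite cardsU1 !card_geq_ord; have := ltn_ord k; have := ltn_ord b.
    by case: (j \notin _); lia.
  have i1n : i.+1 < n.+1 by [].
  pose w := Ordinal i1n.
  have wj : w != j by rewrite -val_eqE /=; lia.
  have tw : t w < k.-1 by have := none w; rewrite wj leqnn /= -ltnNge.
  have zw : i.+1 < z by have := none z; rewrite zj kz; lia.
  have zb' : z < b.
    rewrite ltn_neqAle zb andbT; apply/eqP => /val_inj E.
    by move: kz; rewrite E; lia.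
  have tz := tmax z zj.
  have twb : t w < t b.
    rewrite ltnNge leq_eqVlt; apply/negP => /orP[/eqP/inj E|lt].
      by move: kb; rewrite E /=; lia.
    have := t4231 j w z b; rewrite /occ4231 tj /=; lia.
  (* A value [t p] above [t b] would give a 3412 at [p], [j], [w], [b] if [p < j], and a 4231 at
     [j], [p], [z], [b] if [p > j]. *)
  have : #|[set p : 'I_n.+1 | p < i.+2] :\ j| <= #|[set v : 'I_n.+1 | v < t b]|.
    apply: (@perm_pigeon _ t) => p; rewrite !inE => /andP[pj pi].
    rewrite ltnNge leq_eqVlt; apply/negP => /orP[/eqP/inj E|lt].
      by move: kb; rewrite E; lia.
    have tp := none p; have := t4231 j p z b; have := t3412 p j w b.
    rewrite /occ4231 /occ3412 tj /=; have := tmax p pj.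
    by move: pj tp; rewrite -!val_eqE /=; lia.
  have := cardsD1 j [set p : 'I_n.+1 | p < i.+2].
  rewrite inE !card_lt_ord //; last by have := ltn_ord (t b); lia.
  lia.
apply/neVP; case: (unliftP j b) => [b0 Eb|/eqP]; last by rewrite (negbTE bj).
exists b0; last by rewrite -t_lift -Eb.
by move: kb; rewrite Eb /= /bump; lia.
Qed.

End Deletion.

Definition singular n (s : 'S_n) := #|inversions s| < #|tpairs s|.

(** * Inversion and reverse-complement symmetries *)

Section Symmetries.
Variable n : nat.
Implicit Types (s : 'S_n) (a b c d : 'I_n).

Lemma occ3412V s a b c d :
  occ3412 s a b c d -> occ3412 s^-1 (s c) (s d) (s a) (s b).
Proof. by rewrite /occ3412 !permK; lia. Qed.

Lemma occ4231V s a b c d :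
  occ4231 s a b c d -> occ4231 s^-1 (s d) (s b) (s c) (s a).
Proof. by rewrite /occ4231 !permK; lia. Qed.

Lemma avoids3412V s : avoids (@occ3412 n) s -> avoids (@occ3412 n) s^-1.
Proof. by move=> av a b c d; apply/negP => /occ3412V; rewrite invgK;
  apply/negP/av. Qed.

Lemma singularV s : singular s^-1 = singular s.
Proof.
have sub (r : 'S_n) : #|inversions r| <= #|inversions r^-1%g|.
  pose f (p : 'I_n * 'I_n) := (r p.2, r p.1).
  have finj : injective f by move=> [a b] [c d] [/perm_inj -> /perm_inj ->].
  rewrite -(card_imset _ finj);
    apply/subset_leq_card/subsetP=> _ /imsetP[[a b] ab ->].
  by move: ab; rewrite !inE /= !permK andbC.
have Einv : #|inversions s^-1%g| = #|inversions s|.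
  by apply/eqP; rewrite eqn_leq sub andbT; have := sub s^-1%g; rewrite invgK.
have Et : tpairs s^-1 = tpairs s.
  by apply/setP=> p; rewrite !inE invgK; congr (_ && _); rewrite andbC.
by rewrite /singular Einv Et.
Qed.

(** Conjugation by the longest element: a half-turn of the permutation matrix. *)
Definition revcomp s : 'S_n :=
  (perm (@rev_ord_inj n) * s * perm (@rev_ord_inj n))%g.

Lemma revcompE s a : revcomp s a = rev_ord (s (rev_ord a)).
Proof. by rewrite !permM !permE. Qed.

Lemma revcompK : involutive revcomp.
Proof. by move=> s; apply/permP=> a; rewrite !revcompE !rev_ordK. Qed.

Lemma rev_ord_lt a b : (rev_ord a < rev_ord b) = (b < a).
Proof. by rewrite /=; have := ltn_ord a; have := ltn_ord b; lia. Qed.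

Lemma rev_ord_le a b : (rev_ord a <= rev_ord b) = (b <= a).
Proof. by rewrite leqNgt rev_ord_lt -leqNgt. Qed.

Lemma occ3412_revcomp s a b c d : occ3412 s a b c d ->
  occ3412 (revcomp s) (rev_ord d) (rev_ord c) (rev_ord b) (rev_ord a).
Proof. by rewrite /occ3412 !revcompE !rev_ordK !rev_ord_lt; lia. Qed.

Lemma occ4231_revcomp s a b c d : occ4231 s a b c d ->
  occ4231 (revcomp s) (rev_ord d) (rev_ord c) (rev_ord b) (rev_ord a).
Proof. by rewrite /occ4231 !revcompE !rev_ordK !rev_ord_lt; lia. Qed.

Lemma singular_revcomp s : singular (revcomp s) = singular s.
Proof.
pose f (p : 'I_n * 'I_n) := (rev_ord p.2, rev_ord p.1).
have finj : injective f by apply: (can_inj (g := f)) => -[a b];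
  rewrite /f !rev_ordK.
have eqcard (F : 'S_n -> {set 'I_n * 'I_n}) :
    (forall (r : 'S_n) p, p \in F r -> f p \in F (revcomp r)) ->
      #|F (revcomp s)| = #|F s|.
  move=> h; have sub (r : 'S_n) : #|F r| <= #|F (revcomp r)|.
    rewrite -(card_imset _ finj);
      apply/subset_leq_card/subsetP=> _ /imsetP[p Fp ->].
    exact: h.
  by apply/eqP; rewrite eqn_leq sub andbT; have := sub (revcomp s);
    rewrite revcompK.
rewrite /singular !eqcard // => r [i j]; rewrite !inE /f /=; last first.
  by rewrite !rev_ord_lt !revcompE !rev_ordK rev_ord_lt.
case/and3P=> ij /neP[a ai ja] /neVP[b jb bi]; apply/and3P; split.
- by rewrite rev_ord_lt.
- by apply/neP; exists (rev_ord b); rewrite ?revcompE ?rev_ordK rev_ord_le.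
- by apply/neVP; exists (rev_ord a); rewrite ?revcompE ?rev_ordK rev_ord_le.
Qed.

End Symmetries.

(** * Smoothness as pattern avoidance *)

Lemma perm_insert_maxP n (s : 'S_n.+1) :
  exists s', s = insert_max (s^-1%g ord_max) s'.
Proof.
have [s' Es] := lift_permP s (s^-1%g ord_max).
by exists s'; rewrite {1}Es permKV.
Qed.

Theorem inversions_le_tpairs n (s : 'S_n) : #|inversions s| <= #|tpairs s|.
Proof.
elim: n s => [|n IH] s.
  by rewrite leq_eqVlt; apply/orP; left; apply/eqP/eq_card => -[[]].
have [s' ->] := perm_insert_maxP s;
  apply: leq_trans (card_tpairs_insert_max _ _).
by rewrite card_inversions_insert_max leq_add2r.
Qed.

Lemma smoothN_singular n (s : 'S_n) : smooth s = ~~ singular s.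
Proof. by rewrite smoothE eqn_leq inversions_le_tpairs -leqNgt. Qed.

Lemma singular_insert_max n j (s : 'S_n) :
  singular s -> singular (insert_max j s).
Proof.
rewrite /singular card_inversions_insert_max => ss.
by apply: leq_trans (card_tpairs_insert_max _ _); rewrite ltn_add2r.
Qed.

Theorem avoids_smooth n (s : 'S_n) :
  avoids (@occ3412 n) s -> avoids (@occ4231 n) s -> smooth s.
Proof.
rewrite smoothE; elim: n s => [|n IH] s; first by move=> _ _;
  apply/eqP/eq_card => -[[]].
have [s' ->] := perm_insert_maxP s; set j := (_ ord_max) => s3412 s4231.
have /eqP E : #|inversions s'| == #|tpairs s'|.
  apply: IH => a b c d; first by rewrite -(occ3412_insert_max j).
  by rewrite -(occ4231_insert_max j).
rewrite card_inversions_insert_max E -card_known_pairs eqn_leq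
  !subset_leq_card ?known_pairs_sub //.
exact: tpairs_sub_known.
Qed.

(* By induction it may be assumed that removing an extremal point (a point in
   the first or last row or column) destroys the pattern. *)
Theorem occ4231_singular n (s : 'S_n) a b c d : occ4231 s a b c d -> singular s.
Proof.
elim: n s a b c d => [|n IH] s a b c d; first by case: a.
(* If the largest letter of the pattern is not the maximal value, deleting that value keeps the
   pattern. *)
have core (r : 'S_n.+1) p1 p2 p3 p4 :
  occ4231 r p1 p2 p3 p4 -> r p1 != ord_max -> singular r.
  have [r' ->] := perm_insert_maxP r; set j := (_ ord_max) => o rp1.
  have h p : insert_max j r' p <= insert_max j r' p1 -> exists k, p = lift j k.
    move=> pp1; apply: (@insert_maxP _ j r'); apply: contra rp1 => /eqP E.
    apply/eqP/val_inj/eqP; rewrite eqn_leq leq_ord.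
    by move: pp1; rewrite E.
  have [|q1 E1] := h p1; first by [].
  have [|q2 E2] := h p2; first by move: o; rewrite /occ4231; lia.
  have [|q3 E3] := h p3; first by move: o; rewrite /occ4231; lia.
  have [|q4 E4] := h p4; first by move: o; rewrite /occ4231; lia.
  by apply: singular_insert_max; apply: (IH r' q1 q2 q3 q4);
    rewrite -(occ4231_insert_max j) -E1 -E2 -E3 -E4.
move=> o; apply/negPn/negP => ns.
have sa : s a = ord_max by apply/eqP/negPn/negP=> /(core _ _ _ _ _ o);
  apply/negP.
have d_max : d = ord_max.
  apply/eqP/negPn/negP=> h; case/negP: ns; rewrite -singularV.
  by apply: core (occ4231V o) _; rewrite permK.
have rev_max (e : 'I_n.+1) : rev_ord e = ord_max -> e = ord0.
  by move=> E; apply/val_inj; move/(congr1 val): E => /=; have := ltn_ord e;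
    lia.
have sd : s d = ord0.
  apply/rev_max/eqP/negPn/negP=> h; case/negP: ns; rewrite -singular_revcomp.
  by apply: core (occ4231_revcomp o) _; rewrite revcompE rev_ordK.
have a0 : a = ord0.
  apply/rev_max/eqP/negPn/negP=> h; case/negP: ns.
  rewrite -singularV -singular_revcomp.
  by apply: core (occ4231_revcomp (occ4231V o)) _;
    rewrite revcompE rev_ordK permK.
(* Now [s] has its maximum first and its minimum last, so every pair lies in [tpairs s], while
   [(b, c)] is not an inversion. *)
case/negP: ns; apply: proper_card; rewrite properE; apply/andP; split.
  apply/subsetP=> -[i j]; rewrite !inE /= => /andP[ij _]; rewrite ij /=.
  apply/andP; split; first by apply/neP; exists a; rewrite ?sa ?a0 ?leq_ord.
  by apply/neVP; exists d; rewrite ?sd ?d_max ?leq_ord.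
move: o; rewrite /occ4231 => o; apply/subsetPn; exists (b, c);
  rewrite !inE /=; last by lia.
apply/and3P; split; first by lia.
  by apply/neP; exists a; rewrite ?sa ?a0 ?leq_ord.
by apply/neVP; exists d; rewrite ?sd ?d_max ?leq_ord.
Qed.

(** As for 4231, symmetry and induction leave the case where the letters occupy the extremal rows
    and columns. Then [card_tpairs_insert_max_lt] applies to [s] if [c <= s a], and to its inverse
    otherwise. *)
Theorem occ3412_singular n (s : 'S_n) a b c d : occ3412 s a b c d -> singular s.
Proof.
elim: n s a b c d => [|n IH] s a b c d; first by case: a.
have core (r : 'S_n.+1) p1 p2 p3 p4 :
  occ3412 r p1 p2 p3 p4 -> r p2 != ord_max -> singular r.
  have [r' ->] := perm_insert_maxP r; set j := (_ ord_max) => o rp2.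
  have h p : insert_max j r' p <= insert_max j r' p2 -> exists k, p = lift j k.
    move=> pp2; apply: (@insert_maxP _ j r'); apply: contra rp2 => /eqP E.
    apply/eqP/val_inj/eqP; rewrite eqn_leq leq_ord.
    by move: pp2; rewrite E.
  have [|q1 E1] := h p1; first by move: o; rewrite /occ3412; lia.
  have [|q2 E2] := h p2; first by [].
  have [|q3 E3] := h p3; first by move: o; rewrite /occ3412; lia.
  have [|q4 E4] := h p4; first by move: o; rewrite /occ3412; lia.
  by apply: singular_insert_max; apply: (IH r' q1 q2 q3 q4);
    rewrite -(occ3412_insert_max j) -E1 -E2 -E3 -E4.
move=> o; apply/negPn/negP => ns.
have sb : s b = ord_max by apply/eqP/negPn/negP=> /(core _ _ _ _ _ o);
  apply/negP.
have d_max : d = ord_max.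
  apply/eqP/negPn/negP=> h; case/negP: ns; rewrite -singularV.
  by apply: core (occ3412V o) _; rewrite permK.
have rev_max (e : 'I_n.+1) : rev_ord e = ord_max -> e = ord0.
  by move=> E; apply/val_inj; move/(congr1 val): E => /=; have := ltn_ord e;
    lia.
have sc : s c = ord0.
  apply/rev_max/eqP/negPn/negP=> h; case/negP: ns; rewrite -singular_revcomp.
  by apply: core (occ3412_revcomp o) _; rewrite revcompE rev_ordK.
have a0 : a = ord0.
  apply/rev_max/eqP/negPn/negP=> h; case/negP: ns.
  rewrite -singularV -singular_revcomp.
  by apply: core (occ3412_revcomp (occ3412V o)) _;
    rewrite revcompE rev_ordK permK.
have corner (r : 'S_n.+1) p1 p2 p3 p4 :
  occ3412 r p1 p2 p3 p4 -> r p2 = ord_max -> p1 = ord0 ->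
    r p3 = ord0 -> p3 <= r p1 -> singular r.
  move=> or r2 p10 r3 p31.
  have [r' Er] := perm_insert_maxP r; set j := (_ ord_max) in Er.
  have Ej : j = p2 by rewrite /j -r2 permK.
  rewrite /singular Er card_inversions_insert_max.
  apply: leq_ltn_trans (@card_tpairs_insert_max_lt _ _ _ p1 p3 _ _ _ _ _);
    rewrite -?Er ?Ej //.
  - by rewrite leq_add2r inversions_le_tpairs.
  - by move: or; rewrite /occ3412; lia.
  - by move: or; rewrite /occ3412; lia.
case/negP: ns; case: (leqP c (s a)) => [ca|/ltnW ac];
  first exact: (corner s a b c d).
rewrite -singularV; apply: corner (occ3412V o) _ _ _ _; rewrite ?permK //.
Qed.

Theorem smoothP n (s : 'S_n) :
  smooth s <-> avoids (@occ3412 n) s /\ avoids (@occ4231 n) s.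
Proof.
split=> [|[]]; last exact: avoids_smooth.
rewrite smoothN_singular => ns; split=> a b c d; apply: contra ns.
  exact: occ3412_singular.
exact: occ4231_singular.
Qed.

Lemma covexillaryP n (s : 'S_n) : covexillary s <-> avoids (@occ3412 n) s.
Proof.
split=> [cov a b c d|av]; last first.
  apply/existsPn => f; apply/negP => /forallP h.
  pose p k (lt : k < 4) := f (Ordinal lt).
  have e k l (kl : k < 4) (ll : l < 4) : k < l -> p k kl < p l ll /\
      (s (p k kl) < s (p l ll)) = (nth 0 [:: 3; 4; 1; 2] k < nth 0 [:: 3; 4;
        1; 2] l).
    have /forallP/(_ (Ordinal ll))/implyP/= hkl := h (Ordinal kl).
    by move=> /hkl/andP[-> /eqP].
  have [p01 s01] := e 0 1 isT isT isT; have [p12 _] := e 1 2 isT isT isT.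
  have [p23 s23] := e 2 3 isT isT isT; have [p03 s03] := e 0 3 isT isT isT.
  have /negP[] := av (p 0 isT) (p 1 isT) (p 2 isT) (p 3 isT).
  rewrite /occ3412 p01 p12 p23 s01 s23 andbT /=.
  rewrite ltn_neqAle leqNgt s03 andbT; apply/eqP => /val_inj/perm_inj E.
  by move: p03; rewrite E ltnn.
apply: contra cov; rewrite /occ3412 => o; apply/existsP.
exists [ffun k : 'I_4 => nth a [:: a; b; c; d] k].
apply/forallP=> k; apply/forallP=> l; rewrite !ffunE.
by case: k l => [[|[|[|[|k]]]] //= kl] [[|[|[|[|l]]]] //= ll]; lia.
Qed.

(** * Covexillary permutations and admissible sets *)

Section Closure.
Variable n : nat.
Implicit Types (r s t : 'S_n) (a b c d i j k : 'I_n) (x y z A : nat).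

Lemma covexillaryV s : covexillary s -> covexillary s^-1%g.
Proof. by move=> /covexillaryP/avoids3412V/covexillaryP. Qed.

Lemma cycles23V t : (t^-1%g \in cycles23 n) = (t \in cycles23 n).
Proof.
have sub u : u \in cycles23 n -> u^-1%g \in cycles23 n.
  rewrite !inE => /orP[/existsP[i /existsP[j /andP[ij /eqP->]]]|].
    by apply/orP; left; apply/existsP; exists i; apply/existsP; exists j;
      rewrite tpermV ij eqxx.
  case/existsP=> i /existsP[j /existsP[k /and3P[ij jk h]]].
  apply/orP; right; apply/existsP; exists i; apply/existsP; exists j.
  apply/existsP; exists k; rewrite ij jk /=.
  by case/orP: h => /eqP->; rewrite ?invgK eqxx ?orbT.
by apply/idP/idP => /sub //; rewrite invgK.
Qed.

Lemma tperm_cycles23 i j : i < j -> tperm i j \in cycles23 n.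
Proof.
by move=> ij; rewrite !inE; apply/orP; left; apply/existsP; exists i;
  apply/existsP; exists j; rewrite ij eqxx.
Qed.

Lemma cycle3V_cycles23 i j k :
  i < j -> j < k -> (cycle3 i j k)^-1%g \in cycles23 n.
Proof.
move=> ij jk; rewrite !inE; apply/orP; right; apply/existsP; exists i.
by apply/existsP; exists j; apply/existsP; exists k; rewrite ij jk eqxx orbT.
Qed.

Lemma cycle3_cycles23 i j k : i < j -> j < k -> cycle3 i j k \in cycles23 n.
Proof. by move=> ij jk; rewrite -cycles23V cycle3V_cycles23. Qed.

Lemma covexillary_admissible s : covexillary s -> admissible (cycles_below s).
Proof.
move=> /covexillaryP s3412; split.
- by apply/subsetP=> t; rewrite inE => /andP[].
- move=> t u; rewrite !inE => /andP[_ ts] -> ut /=; exact: bruhat_trans ts.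
- move=> i j k l ij jl ik kl; rewrite ![_ \in cycles_below _]inE.
  rewrite bruhat_cycle3 // bruhat_cycle3V // bruhat_tperm;
    last exact: ltn_trans jl.
  case/andP=> _ /and3P[_ _ ->] /andP[_ /and3P[_ _ ->]].
  by rewrite tperm_cycles23 // (ltn_trans ij).
move=> i j k ij jk; rewrite ![_ \in cycles_below _]inE.
rewrite !cycle3V_cycles23 ?cycle3_cycles23 ?tperm_cycles23 //=.
rewrite bruhat_cycle3 // bruhat_cycle3V // !bruhat_tperm //.
case/andP=> nij nVij /andP[njk nVjk]; rewrite nij nVij njk nVjk /=.
(* If both 3-cycles fail, neither [s] nor its inverse reaches [k] on [[0, i]], so the witnesses of
   the four remaining conditions form a 3412. *)
apply/orP/negPn/negP; rewrite negb_or => /andP[/neVP nV /neP nn].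
case/neP: nij => a ai ja; case/neVP: nVij => c jc ci.
case/neP: njk => b bj kb; case/neVP: nVjk => d kd dj.
have /negP[] := s3412 a b c d; rewrite /occ3412.
have ib : i < b by rewrite ltnNge; apply/negP => h; apply: nn; exists b.
have id : i < s d by rewrite ltnNge; apply/negP => h; apply: nV; exists d.
have ak : s a < k by rewrite ltnNge; apply/negP => h; apply: nn; exists a.
have ck : c < k by rewrite ltnNge; apply/negP => h; apply: nV; exists c.
have bc : b <> c :> nat by move=> /val_inj E; move: kb; rewrite E; lia.
have da : s d <> s a :> nat by move=> /val_inj/perm_inj E; move: kd;
  rewrite E; lia.
by lia.
Qed.

Lemma cycles_below_sub s t :
  ne_le s t -> cycles_below s \subset cycles_below t.
Proof.
case=> st stV; apply/subsetP=> u; rewrite !inE => /andP[cu us]; rewrite cu /=.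
case/orP: cu us => [/existsP[i /existsP[j /andP[ij /eqP->]]]|].
  by rewrite !bruhat_tperm // => /andP[/st-> /stV->].
case/existsP=> i /existsP[j /existsP[k /and3P[ij jk /orP[] /eqP->]]].
  by rewrite !bruhat_cycle3 // => /and3P[/st-> /st-> /stV->].
by rewrite !bruhat_cycle3V // => /and3P[/stV-> /stV-> /st->].
Qed.

(** * Jumps of the running maxima *)

(** [A] is the maximum of [s] on [[0, x]] and [y.+1] the first position with a larger value, which
    exists because [z < n] is a value of [s]. *)
Lemma ne_jump s x z a : a <= x -> z < n -> ~~ ne s x z ->
  exists y A, [/\ x <= y, ne s x A, A < z, ~~ ne s y A.+1 & ne s y.+1 A.+1].
Proof.
move=> ax zn nxz.
pose u := [arg max_(u > a | u <= x) s u].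
have [ux um] : u <= x /\ forall v : 'I_n, v <= x -> s v <= s u.
  by rewrite /u; case: arg_maxnP.
have xu : ne s x (s u) by apply/neP; exists u.
have nxu : ~~ ne s x (s u).+1 by apply/neP => -[v vx]; have := um v vx; lia.
have uz : s u < z by rewrite ltnNge; apply: contra nxz => h; apply: ne_mono xu.
have ex : exists y, ne s y (s u).+1.
  exists n; apply/neP; exists (s^-1%g (Ordinal zn)); rewrite ?permKV //.
  exact/ltnW/ltn_ord.
case: (ex_minnP ex) => -[|y] ny ymin.
  by case/negP: nxu; apply: ne_mono ny.
exists y, (s u); split=> //; last by apply/negP => /ymin; rewrite ltnn.
by rewrite leqNgt; apply: contra nxu => yx; apply: ne_mono ny.
Qed.

(** Were [A < y], the first [A.+2] positions would only take the [A.+1] values up to [A]. *)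
Lemma jump_le s y A : ~~ ne s y A.+1 -> ne s y.+1 A.+1 -> y <= A.
Proof.
move=> nyA yA; rewrite leqNgt; apply/negP => Ay.
have An : A.+1 < n by case/neP: yA => a _; have := ltn_ord (s a); lia.
have : ~~ ne s A.+1 A.+2 by apply: contra nyA; apply: ne_mono.
have : #|[set p : 'I_n | p < A.+2]| <= #|[set v : 'I_n | v < A.+1]|.
  apply: (@perm_pigeon _ s) => p; rewrite !inE => pA.
  by rewrite ltnNge; apply: contra nyA => h; apply/neP; exists p; lia.
by rewrite !card_lt_ord; lia.
Qed.

Lemma jump_val s y A (A_y : ne s y A) : ~~ ne s y A.+1 -> ne s y.+1 A.+1 ->
  exists a b, [/\ a <= y, s a = A :> nat, b = y.+1 :> nat & A < s b].
Proof.
move=> nyA /neP[b by1 Ab]; case/neP: A_y => a ay Aa; exists a, b; split=> //.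
  apply/eqP; rewrite eqn_leq Aa andbT leqNgt; apply: contra nyA => h.
  by apply/neP; exists a.
apply/eqP; rewrite eqn_leq by1 ltnNge; apply: contra nyA => h.
by apply/neP; exists b.
Qed.

(** Otherwise the last position [e] with value at most [y] precedes [A]. The positions after [e] are
    too many to take only values above [A], and one of them with value below [A] completes a 3412
    with [a], [b], [e]. *)
Lemma covexillary_jump s y A : covexillary s ->
  ne s y A -> ~~ ne s y A.+1 -> ne s y.+1 A.+1 -> ne s^-1 y A.
Proof.
move=> /covexillaryP s3412 yA nyA y1A; apply: contraT => nV.
have yleA := jump_le nyA y1A.
have [a [b [ay sa Eb Ab]]] := jump_val yA nyA y1A.
have An : A < n by rewrite -sa.
have [e ye emax] : exists2 e : 'I_n, s e <= y &
    forall d : 'I_n, s d <= y -> d <= e.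
  have yn : y < n by lia.
  pose e := [arg max_(e > s^-1%g (Ordinal yn) | s e <= y) e : nat].
  have [h1 h2] : s e <= y /\ forall d : 'I_n, s d <= y -> d <= e.
    by rewrite /e; case: arg_maxnP; rewrite ?permKV.
  by exists e.
have eA : e < A by rewrite ltnNge; apply: contra nV => h; apply/neVP; exists e.
have yA' : y < A.
  rewrite ltn_neqAle yleA andbT; apply/eqP => E.
  have : #|[set p : 'I_n | y <= p]| <= #|[set v : 'I_n | y < v]|.
    apply: (@perm_pigeon _ s) => p; rewrite !inE => yp.
    by rewrite ltnNge; apply: contra nV => h; apply/neVP; exists p;
      rewrite // -E.
  by rewrite !card_geq_ord; lia.
have /ne_diagV/neVP[b' yb' b'y] : ne s y y.+1 by apply: ne_mono yA.
have be : b < e.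
  rewrite Eb ltn_neqAle (leq_trans yb') ?emax // andbT; apply/eqP => E.
  by have := ye; rewrite -(_ : b = e); [lia | apply/val_inj; rewrite /= Eb].
have [/existsP[d /andP[ed dA]]|/existsPn none] := boolP [exists d :
  'I_n, (e < d) && (s d < A)].
  have yd : y < s d by rewrite ltnNge; apply/negP => /emax; rewrite leqNgt ed.
  have /negP[] := s3412 a b e d; rewrite /occ3412; lia.
have : #|[set p : 'I_n | e < p]| <= #|[set v : 'I_n | A < v]|.
  apply: (@perm_pigeon _ s) => p; rewrite !inE => ep.
  have := none p; rewrite ep /= -leqNgt leq_eqVlt => /orP[/eqP E|//].
  have Ea : a = p by apply/(@perm_inj _ s)/val_inj; rewrite /= sa.
  by move: ep; rewrite -Ea; lia.
by rewrite !card_geq_ord; lia.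
Qed.

(** If the maximum on [[0, x]] reached [z] for [r] but not for [s], the first jump of [s] from [x]
    on would be detected by a transposition or 3-cycle. *)
Lemma cycles_below_ne r s : covexillary s ->
  cycles_below r = cycles_below s -> forall x z, ne r x z -> ne s x z.
Proof.
move=> cov rs x z; apply: contraTT => nsx; apply/negP => rxz.
have below t : t \in cycles23 n -> bruhat t r = bruhat t s.
  by move=> ct; move/setP/(_ t): rs; rewrite ![_ \in cycles_below _]inE ct.
have [a ax za] := neP _ _ _ rxz.
have zn : z < n by apply: leq_ltn_trans za _.
have [y [A [xy sxA Az nyA y1A]]] := ne_jump ax zn nsx.
have syA : ne s y A by apply: ne_mono sxA.
have ryA : ne r y A.+1 by apply: ne_mono rxz.
have yA := jump_le nyA y1A.
have A1n : A.+1 < n by lia.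
have An : A < n by lia.
have yn : y < n by lia.
have sVyA := covexillary_jump cov syA nyA y1A.
case/negP: nyA; have [E|yneA] := eqVneq y A.
  have := below _ (tperm_cycles23 (i := Ordinal yn) (j := Ordinal A1n) _).
  rewrite !bruhat_tperm /= ?E // ne_diag -E; move: ryA;
    rewrite -E => -> /(_ (ltnSn _)).
  by move/esym/andP => [].
have {yneA}yltA : y < A by lia.
(* By [covexillary_jump] this transposition is below [s], hence below [r]. That puts the inverse
   3-cycle on [y], [A], [A.+1] below [r], hence below [s], and forces [ne s y A.+1]. *)
have : bruhat (tperm (Ordinal yn) (Ordinal An)) r.
  by rewrite below ?tperm_cycles23 // bruhat_tperm //= syA.
rewrite bruhat_tperm //= => /andP[_ rVyA].
have : bruhat (cycle3 (Ordinal yn) (Ordinal An) (Ordinal A1n))^-1%g s.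
  rewrite -below ?cycle3V_cycles23 // bruhat_cycle3V //= rVyA ryA ne_diag andbT.
  by apply: ne_mono ryA => //; apply: ltnW.
by rewrite bruhat_cycle3V //= => /and3P[].
Qed.

Lemma cycles_belowV r s :
  cycles_below r = cycles_below s -> cycles_below r^-1%g = cycles_below s^-1%g.
Proof.
move=> rs; apply/setP=> t;
  rewrite ![_ \in cycles_below _]inE -(cycles23V t) -!(bruhatV t) !invgK.
by move/setP/(_ t^-1%g): rs; rewrite ![_ \in cycles_below _]inE.
Qed.

Lemma cycles_below_ne_le r s :
  covexillary s -> cycles_below r = cycles_below s -> ne_le r s.
Proof.
move=> cov rs; split=> x z; first exact: cycles_below_ne.
by apply: cycles_below_ne; [apply: covexillaryV | apply: cycles_belowV].
Qed.

(** * Removing occurrences of 4231 *)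

(** The points at [b] and [c] stay in the rectangle spanned by those at [a] and [d], which witness
    every [ne] condition that they do. *)
Lemma swap_4231 s t a b c d : occ4231 s a b c d ->
  t = (tperm b c * s)%g -> ne_le s t /\ ne_le t s.
Proof.
move=> o Et.
have [ab bc cd] : [/\ a < b, b < c & c < d].
  by case/and5P: o.
have tE (u : 'I_n) : t u = s (tperm b c u) by rewrite Et permM.
have ta : t a = s a by rewrite tE tpermD // -val_eqE /=; lia.
have td : t d = s d by rewrite tE tpermD // -val_eqE /=; lia.
have near (u : 'I_n) :
  t u = s u \/ [/\ a < u, u < d & [/\ s d < s u, s u < s a,
  s d < t u & t u < s a]].
  rewrite tE; case: tpermP => [->|->|_ _]; last by left.
    by right; move: o; rewrite /occ4231 => h; split; [lia | lia | split; lia].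
  by right; move: o; rewrite /occ4231 => h; split; [lia | lia | split; lia].
split; split=> x y.
- move=> /neP[u ux yu]; apply/neP; have [E|[au _ [_ sua _ _]]] := near u.
    by exists u; rewrite ?E.
  by exists a; rewrite ?ta; lia.
- move=> /neVP[u yu ux]; apply/neVP; have [E|[_ ud [sdu _ _ _]]] := near u.
    by exists u; rewrite ?E.
  by exists d; rewrite ?td; lia.
- move=> /neP[u ux yu]; apply/neP; have [E|[au _ [_ _ _ tua]]] := near u.
    by exists u; rewrite -?E.
  by exists a; lia.
- move=> /neVP[u yu ux]; apply/neVP; have [E|[_ ud [_ _ sdt _]]] := near u.
    by exists u; rewrite -?E.
  by exists d; lia.
Qed.

(** Termination measure: by the rearrangement inequality, exchanging the letters of a non-inversion
    lowers it. *)
Definition weight s := \sum_(i < n) i * s i.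

Lemma weight_swap s b c : b < c -> s b < s c ->
  weight (tperm b c * s)%g < weight s.
Proof.
move=> bc sbc; have cb : c != b by rewrite -val_eqE /= gtn_eqF.
rewrite /weight (bigD1 b) // (bigD1 c) //= [X in _ < X](bigD1 b) // [X in _ <
  _ + X](bigD1 c) //=.
rewrite !permM tpermL tpermR.
set R := \sum_(i < n | _) _; set R' := \sum_(i < n | _) _.
have -> : R = R'.
  by apply: eq_bigr => i /andP[ib ic]; rewrite permM tpermD // eq_sym.
by nia.
Qed.

Lemma exists_avoids_4231 s :
  exists t, [/\ ne_le s t, ne_le t s & avoids (@occ4231 n) t].
Proof.
elim/ltn_ind: {s}(weight s) {-2}s (erefl (weight s)) => m IH s Em.
have [|av] := boolP [exists a, exists b, exists c, exists d, occ4231 s a b c d].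
  case/existsP=> a /existsP[b /existsP[c /existsP[d o]]].
  have [st ts] := swap_4231 o erefl.
  have lt : weight (tperm b c * s)%g < m.
    by rewrite -Em weight_swap //; move: o; rewrite /occ4231; lia.
  have [t [h1 h2 h3]] := IH _ lt _ erefl.
  by exists t; split=> //; [apply: ne_le_trans h1 | apply: ne_le_trans ts].
exists s; split=> // a b c d; apply: contra av => o.
by apply/existsP; exists a; apply/existsP; exists b; apply/existsP; exists c;
  apply/existsP; exists d.
Qed.

Lemma ne_jump_between s a b : a < b -> s a < s b -> ~~ ne s a (s b) ->
  exists y A, [/\ y < b, s a <= A, ne s y A, ~~ ne s y A.+1 & ne s y.+1 A.+1].
Proof.
move=> ab sab nab.
have [y [A [ay saA Ab nyA y1A]]] := ne_jump (leqnn a) (ltn_ord (s b)) nab.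
exists y, A; split=> //; last exact: ne_mono saA.
  by rewrite ltnNge; apply: contra nyA => bY; apply/neP; exists b.
by rewrite leqNgt; apply: contra nyA => As; apply/neP; exists a.
Qed.

(** As [t] avoids 4231, a 3412 in [t] forces a jump of its maxima between [a] and [b], and one for
    its inverse between [t c] and [t d]. These jumps are shared with [s], where their points form a
    3412. *)
Lemma covexillary_transfer s t : covexillary s -> ne_le s t -> ne_le t s ->
  avoids (@occ4231 n) t -> avoids (@occ3412 n) t.
Proof.
move=> /covexillaryP s3412 [st stV] [ts tsV] t4231 a b c d; apply/negP.
have neq (u v : 'I_n) : (t u : nat) <> t v -> (u : nat) <> v.
  by move=> h /val_inj E; apply: h; rewrite E.
have tneq (u v : 'I_n) : (u : nat) <> v -> (t u : nat) <> t v.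
  by move=> h /val_inj/perm_inj E; apply: h; rewrite E.
rewrite /occ3412 => o.
have [|||y [A [yb aA tyA nyA y1A]]] := @ne_jump_between t a b; try lia.
  apply/neP => -[u ua tu]; have := t4231 u a b c; rewrite /occ4231.
  have : (u : nat) <> a by apply: neq; lia.
  have : (t u : nat) <> t b by apply: tneq; lia.
  by lia.
have nV : ~~ ne t^-1 (t c) d.
  apply/neVP => -[u du tu]; have := t4231 b c d u; rewrite /occ4231.
  have : (t u : nat) <> t c by apply: tneq; lia.
  have : (u : nat) <> d by apply: neq; lia.
  by lia.
have [|||x [C [xd cC txC nxC x1C]]] := @ne_jump_between t^-1%g (t c) (t d);
  rewrite ?permK //; try lia.
rewrite permK in cC.
have [|||a' [b' [a'y sa' Eb' Ab']]] := @jump_val s y A;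
  [exact: ts | | exact: ts |].
  by apply: contra nyA; apply: st.
have [|||c' [d' [c'x sc' Ed' Cd']]] := @jump_val s^-1%g x C;
  [exact: tsV | | exact: tsV |].
  by apply: contra nxC; apply: stV.
(* The bounds [t a <= A] and [c <= C] separate the points of the two jumps. *)
have /negP[] := s3412 a' b' (s^-1%g c') (s^-1%g d').
by rewrite /occ3412 !permKV; lia.
Qed.

Lemma exists_smooth_closure s : covexillary s ->
  exists t, [/\ smooth t, ne_le s t & ne_le t s].
Proof.
move=> cov; have [t [st ts t4231]] := exists_avoids_4231 s.
exists t; split=> //; apply: avoids_smooth => //.
exact: covexillary_transfer cov st ts t4231.
Qed.

(** * The smooth closure and its extremal properties *)

Lemma smooth_covexillary s : smooth s -> covexillary s.
Proof. by move/smoothP=> [/covexillaryP]. Qed.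

Lemma smooth_bruhat r s : smooth s -> ne_le r s -> bruhat r s.
Proof. by case/smoothP => h1 h2; apply: ne_le_bruhat. Qed.

Lemma ne_le_cycles_below s t :
  ne_le s t -> ne_le t s -> cycles_below s = cycles_below t.
Proof. by move=> st ts; apply/eqP; rewrite eqEsubset !cycles_below_sub. Qed.

(** Any [r] with the same cycles has its maxima bounded by those of [s], hence of [t], and
    smoothness of [t] turns this into the Bruhat order. *)
Lemma greatest_smooth s t : covexillary s -> smooth t ->
  ne_le s t -> ne_le t s ->
    greatest [set r | cycles_below r == cycles_below s] t.
Proof.
move=> cov smt st ts; apply/andP; split.
  by rewrite inE (ne_le_cycles_below st ts).
apply/forall_inP=> r; rewrite inE => /eqP rs; apply: smooth_bruhat => //.
exact: ne_le_trans (cycles_below_ne_le cov rs) st.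
Qed.

(** A greatest element is unique by antisymmetry, so the element picked can only be [s]. *)
Lemma pi_adm_greatest (A : {set 'S_n}) s :
  greatest [set t | cycles_below t == A] s -> pi_adm A = s.
Proof.
rewrite /pi_adm => gs; case: pickP => [t gt|/(_ s)]; last by rewrite gs.
have [/andP[sA /forall_inP hs] /andP[tA /forall_inP ht]] := (gs, gt).
exact: bruhat_anti (ht _ sA) (hs _ tA).
Qed.

Lemma pi_admP s (t := pi_adm (cycles_below s)) : covexillary s ->
  [/\ smooth t, ne_le s t, ne_le t s &
      greatest [set r | cycles_below r == cycles_below s] t].
Proof.
move=> cov; have [u [smu su us]] := exists_smooth_closure cov.
have gu := greatest_smooth cov smu su us.
by rewrite /t (pi_adm_greatest gu).
Qed.

Lemma pi_adm_smooth s : smooth s -> pi_adm (cycles_below s) = s.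
Proof.
move=> sms; apply: pi_adm_greatest.
by apply: greatest_smooth => //; apply: smooth_covexillary.
Qed.

End Closure.

Theorem theorem1p5 (n : nat) (n_gt0 : 0 < n) :
  let f := fun t : 'S_n => pi_adm (cycles_below t) in
  [/\ forall t : 'S_n, covexillary t -> admissible (cycles_below t),
      forall t : 'S_n, covexillary t ->
        greatest [set s | cycles_below s == cycles_below t] (f t),
      [/\ [set s : 'S_n | smooth s] \subset [set s : 'S_n | covexillary s],
          f @: [set t | covexillary t] = [set s | smooth s]
        & forall t : 'S_n, covexillary t -> f (f t) = f t],
      forall t u : 'S_n, covexillary t -> covexillary u ->
        bruhat t u -> bruhat (f t) (f u)
    & forall t : 'S_n, covexillary t ->
        least [set s | smooth s && bruhat t s] (f t)].
Proof.
split.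
- exact: covexillary_admissible.
- by move=> t /pi_admP[].
- split.
  + by apply/subsetP=> s; rewrite !inE; apply: smooth_covexillary.
  + apply/setP=> s; rewrite inE; apply/imsetP/idP => [[t]|sms].
      by rewrite inE => /pi_admP[smt _ _ _] ->.
    by exists s; rewrite ?inE ?smooth_covexillary ?pi_adm_smooth.
  + by move=> t /pi_admP[smt _ _ _]; apply: pi_adm_smooth.
- move=> t u /pi_admP[_ _ ft _] /pi_admP[smu uf _ _] /bruhat_ne_le tu.
  exact: smooth_bruhat smu (ne_le_trans ft (ne_le_trans tu uf)).
move=> t /pi_admP[smt tf ft _]; apply/andP; split.
  by rewrite inE smt smooth_bruhat.
apply/forall_inP=> s; rewrite inE => /andP[sms /bruhat_ne_le ts].
exact: smooth_bruhat sms (ne_le_trans ft ts).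
Qed.
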